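(* Let $P$ be a well-formed program of Core Choreographies, $s$ a state, $\vec\lambda$ a list of observable labels and $c'=(P',s')$ a configuration with $(P,s)\xrightarrow{\vec\lambda}{}^{*}c'$. Then either the main choreography of $P'$ is $\mathsf{end}$, or there exist an observable label $\lambda$ and a configuration $c''$ with $c'\xrightarrow{\lambda}c''$.
   Context: Fix types with decidable equality of process names $\mathsf{Pid}$, variables $\mathsf{Var}$, values $\mathsf{Val}$, expressions, Boolean expressions, procedure names $\mathsf{RecVar}$, annotations, and evaluation functions $\mathrm{eval}$ (expression and local state $\mathsf{Var}\to\mathsf{Val}$ to value) and $\mathrm{beval}$ (Boolean expression and local state to Boolean), invariant under extensional equality of local states. Labels: $\mathsf{left},\mathsf{right}$. A state is $s:\mathsf{Pid}\to\mathsf{Var}\to\mathsf{Val}$; $s\equiv s'$ is extensional equality; $s[q,x\mapsto v]$ is update. Interactions $\eta::=p.e\to q.x\mid p\to q[l]$ (processes $\{p,q\}$); choreographies $C::=\eta@a;C\mid\mathsf{if}\ p.b\ \mathsf{then}\ C_1\ \mathsf{else}\ C_2\mid\mathsf{call}\ X\mid\mathsf{rtcall}\ X\ ps\ C\mid\mathsf{end}$, $ps$ a list of processes. $D:\mathsf{RecVar}\to\mathrm{list}(\mathsf{Pid})\times\mathsf{Chor}$, $D\,X=(\mathrm{Vars}\,X,\mathrm{Body}\,X)$; a program is $(D,C)$ ($C$ is its main choreography), a configuration is a pair (program, state). Rich labels $\mathrm{com}(p,v,q,x),\mathrm{sel}(p,q,l),\mathrm{cond}(p),\mathrm{call}(X,p)$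 with processes $\{p,q\},\{p,q\},\{p\},\{p\}$. $\langle C,s\rangle\xrightarrow{\rho}_D\langle C',s'\rangle$ is the least relation with: $\langle p.e\to q.x@a;C,s\rangle\xrightarrow{\mathrm{com}(p,v,q,x)}\langle C,s'\rangle$ if $v=\mathrm{eval}(e,s\,p)$, $s'\equiv s[q,x\mapsto v]$; $\langle p\to q[l]@a;C,s\rangle\xrightarrow{\mathrm{sel}(p,q,l)}\langle C,s'\rangle$ if $s\equiv s'$; $\langle\mathsf{if}\ p.b\ \mathsf{then}\ C_1\ \mathsf{else}\ C_2,s\rangle\xrightarrow{\mathrm{cond}(p)}\langle C_1,s'\rangle$ (resp. $C_2$) if $\mathrm{beval}(b,s\,p)$ is true (resp. false), $s\equiv s'$; $\langle\eta@a;C,s\rangle\xrightarrow{\rho}\langle\eta@a;C',s'\rangle$ if $\langle C,s\rangle\xrightarrow{\rho}\langle C',s'\rangle$ and processes of $\eta$, $\rho$ are disjoint; $\langle\mathsf{if}\ p.b\ \mathsf{then}\ C_1\ \mathsf{else}\ C_2,s\rangle\xrightarrow{\rho}\langle\mathsf{if}\ p.b\ \mathsf{then}\ C_1'\ \mathsf{else}\ C_2',s'\rangle$ if $p$ not in $\rho$ and $\langle C_i,s\rangle\xrightarrow{\rho}\langle C_i',s'\rangle$, $i=1,2$; $\langle\mathsf{rtcall}\ X\ ps\ C,s\rangle\xrightarrow{\rho}\langle\mathsf{rtcall}\ X\ ps\ C',s'\rangle$ if no process of $\rho$ is in $ps$ and $\langle C,s\rangle\xrightarrow{\rho}\langle C',s'\rangle$;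 for $s\equiv s'$, $p\in\mathrm{Vars}\,X$: $\langle\mathsf{call}\ X,s\rangle\xrightarrow{\mathrm{call}(X,p)}\langle\mathrm{Body}\,X,s'\rangle$ if $\#\mathrm{Vars}\,X=1$, and $\langle\mathsf{rtcall}\ X\ (\mathrm{Vars}\,X\setminus p)\ (\mathrm{Body}\,X),s'\rangle$ if $\#\mathrm{Vars}\,X>1$; for $s\equiv s'$, $p\in ps$: $\langle\mathsf{rtcall}\ X\ ps\ C,s\rangle\xrightarrow{\mathrm{call}(X,p)}\langle\mathsf{rtcall}\ X\ (ps\setminus p)\ C,s'\rangle$ if $\#ps>1$ and $\langle C,s'\rangle$ if $\#ps=1$ ($\#$ is list size, $\setminus p$ removes $p$). Observable labels: $\mathrm{forget}(\mathrm{com}(p,v,q,x))=\mathrm{com}(p,v,q)$, $\mathrm{forget}(\mathrm{sel}(p,q,l))=\mathrm{sel}(p,q,l)$, $\mathrm{forget}(\mathrm{cond}(p))=\mathrm{forget}(\mathrm{call}(X,p))=\tau(p)$; $((D,C),s)\xrightarrow{\mathrm{forget}(\rho)}((D,C'),s')$ iff $\langle C,s\rangle\xrightarrow{\rho}_D\langle C',s'\rangle$. Multi-step: $(P,s)\xrightarrow{[\,]}{}^{*}(P,s')$ whenever $s\equiv s'$, and $c_1\xrightarrow{\lambda::\vec\lambda}{}^{*}c_3$ if $c_1\xrightarrow{\lambda}c_2$ and $c_2\xrightarrow{\vec\lambda}{}^{*}c_3$. Well-formedness of $(D,C)$: $C$ contains no self-interaction ($p.e\to p.x$ or $p\to p[l]$),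 every $\mathsf{rtcall}\ X\ ps\ C'$ in $C$ has $ps$ nonempty with $ps\subseteq\mathrm{Vars}\,X$; for every $X$, $\mathrm{Body}\,X$ contains no self-interaction and no $\mathsf{rtcall}$, $\mathrm{Vars}\,X$ is nonempty, and every process occurring in $\mathrm{Body}\,X$ (counting, for each $\mathsf{call}\ Y$ in it, the processes of $\mathrm{Vars}\,Y$) is in $\mathrm{Vars}\,X$. *)

(* Defs.v *)
From mathcomp Require Import all_boot.
Set Implicit Arguments.
Unset Strict Implicit.
Unset Printing Implicit Defensive.

Record signature := Signature {
  Pid : eqType;
  Var : eqType;
  Val : eqType;
  Expr : eqType;
  BExpr : eqType;
  RecVar : eqType;
  Ann : eqType;
  eval : Expr -> (Var -> Val) -> Val;
  beval : BExpr -> (Var -> Val) -> bool;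
  eval_ext : forall e f g, f =1 g -> eval e f = eval e g;
  beval_ext : forall b f g, f =1 g -> beval b f = beval b g
}.

Definition state (S : signature) := Pid S -> Var S -> Val S.

(** Extensional equality of states is [s =2 s']. *)
Definition update (S : signature) (s : state S) (q : Pid S) (x : Var S)
    (v : Val S) : state S :=
  fun p y => if (p == q) && (y == x) then v else s p y.

Inductive label := Left | Right.

Inductive eta (S : signature) :=
| Com of Pid S & Expr S & Pid S & Var S
| Sel of Pid S & Pid S & label.

Definition eta_procs (S : signature) (i : eta S) : seq (Pid S) :=
  match i with
  | Com p _ q _ => [:: p; q]
  | Sel p q _ => [:: p; q]
  end.

Inductive chor (S : signature) :=
| Interact of eta S & Ann S & chor S
| Cond of Pid S & BExpr S & chor S & chor S
| Call of RecVar S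
| RTCall of RecVar S & seq (Pid S) & chor S
| End.
Arguments Call {S} _.
Arguments End {S}.

Definition defs (S : signature) := RecVar S -> seq (Pid S) * chor S.
Definition Vars (S : signature) (D : defs S) X := (D X).1.
Definition Body (S : signature) (D : defs S) X := (D X).2.

Definition program (S : signature) := (defs S * chor S)%type.
Definition procedures (S : signature) (P : program S) : defs S := P.1.
Definition main (S : signature) (P : program S) : chor S := P.2.

Definition config (S : signature) := (program S * state S)%type.

(** [R] is for rich labels, [O] (below) for observable ones. *)
Inductive rlabel (S : signature) :=
| RCom of Pid S & Val S & Pid S & Var S
| RSel of Pid S & Pid S & label
| RCond of Pid S
| RCall of RecVar S & Pid S.
Arguments RCond {S} _.

Definition rlabel_procs (S : signature) (r : rlabel S) : seq (Pid S) :=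
  match r with
  | RCom p _ q _ => [:: p; q]
  | RSel p q _ => [:: p; q]
  | RCond p => [:: p]
  | RCall _ p => [:: p]
  end.

Inductive olabel (S : signature) :=
| OCom of Pid S & Val S & Pid S
| OSel of Pid S & Pid S & label
| OTau of Pid S.
Arguments OTau {S} _.

Definition forget (S : signature) (r : rlabel S) : olabel S :=
  match r with
  | RCom p v q _ => OCom p v q
  | RSel p q l => OSel p q l
  | RCond p => OTau p
  | RCall _ p => OTau p
  end.

Definition disjoint_procs (S : signature) (ps qs : seq (Pid S)) : bool :=
  ~~ has (mem ps) qs.

(** Lists of processes may contain duplicates: [size] counts them, and [rem]
    removes a single occurrence, so that a list of size greater than one never
    becomes empty. *)
Inductive red (S : signature) (D : defs S) :
    chor S -> state S -> rlabel S -> chor S -> state S -> Prop :=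
| red_com p e q x a C s s' v :
    v = eval e (s p) -> s' =2 update s q x v ->
    red D (Interact (Com p e q x) a C) s (RCom p v q x) C s'
| red_sel p q l a C s s' :
    s =2 s' ->
    red D (Interact (Sel p q l) a C) s (RSel p q l) C s'
| red_then p b C1 C2 s s' :
    beval b (s p) = true -> s =2 s' ->
    red D (Cond p b C1 C2) s (RCond p) C1 s'
| red_else p b C1 C2 s s' :
    beval b (s p) = false -> s =2 s' ->
    red D (Cond p b C1 C2) s (RCond p) C2 s'
| red_delay_eta i a C C' s s' r :
    disjoint_procs (eta_procs i) (rlabel_procs r) ->
    red D C s r C' s' ->
    red D (Interact i a C) s r (Interact i a C') s'
| red_delay_cond p b C1 C2 C1' C2' s s' r :
    p \notin rlabel_procs r ->
    red D C1 s r C1' s' -> red D C2 s r C2' s' ->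
    red D (Cond p b C1 C2) s r (Cond p b C1' C2') s'
| red_delay_rtcall X ps C C' s s' r :
    disjoint_procs ps (rlabel_procs r) ->
    red D C s r C' s' ->
    red D (RTCall X ps C) s r (RTCall X ps C') s'
| red_call_one X p s s' :
    s =2 s' -> p \in Vars D X -> size (Vars D X) = 1 ->
    red D (Call X) s (RCall X p) (Body D X) s'
| red_call_many X p s s' :
    s =2 s' -> p \in Vars D X -> 1 < size (Vars D X) ->
    red D (Call X) s (RCall X p) (RTCall X (rem p (Vars D X)) (Body D X)) s'
| red_enter X p ps C s s' :
    s =2 s' -> p \in ps -> 1 < size ps ->
    red D (RTCall X ps C) s (RCall X p) (RTCall X (rem p ps) C) s'
| red_finish X p ps C s s' :
    s =2 s' -> p \in ps -> size ps = 1 ->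
    red D (RTCall X ps C) s (RCall X p) C s'.

Inductive step (S : signature) : config S -> olabel S -> config S -> Prop :=
| step_red D C C' s s' r :
    red D C s r C' s' -> step ((D, C), s) (forget r) ((D, C'), s').

Inductive steps (S : signature) :
    config S -> seq (olabel S) -> config S -> Prop :=
| steps_nil P s s' : s =2 s' -> steps (P, s) [::] (P, s')
| steps_cons c1 c2 c3 l ls :
    step c1 l c2 -> steps c2 ls c3 -> steps c1 (l :: ls) c3.

Definition eta_no_self (S : signature) (i : eta S) : bool :=
  match i with
  | Com p _ q _ => p != q
  | Sel p q _ => p != q
  end.

Fixpoint no_self (S : signature) (C : chor S) : bool :=
  match C with
  | Interact i _ C1 => eta_no_self i && no_self C1
  | Cond _ _ C1 C2 => no_self C1 && no_self C2
  | Call _ => true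
  | RTCall _ _ C1 => no_self C1
  | End => true
  end.

Fixpoint no_rtcall (S : signature) (C : chor S) : bool :=
  match C with
  | Interact _ _ C1 => no_rtcall C1
  | Cond _ _ C1 C2 => no_rtcall C1 && no_rtcall C2
  | Call _ => true
  | RTCall _ _ _ => false
  | End => true
  end.

Fixpoint rtcalls_ok (S : signature) (D : defs S) (C : chor S) : bool :=
  match C with
  | Interact _ _ C1 => rtcalls_ok D C1
  | Cond _ _ C1 C2 => rtcalls_ok D C1 && rtcalls_ok D C2
  | Call _ => true
  | RTCall X ps C1 =>
      [&& ps != [::], all (mem (Vars D X)) ps & rtcalls_ok D C1]
  | End => true
  end.

Fixpoint chor_procs (S : signature) (D : defs S) (C : chor S) : seq (Pid S) :=
  match C with
  | Interact i _ C1 => eta_procs i ++ chor_procs D C1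
  | Cond p _ C1 C2 => p :: chor_procs D C1 ++ chor_procs D C2
  | Call Y => Vars D Y
  | RTCall _ ps C1 => ps ++ chor_procs D C1
  | End => [::]
  end.

Definition well_formed (S : signature) (P : program S) : Prop :=
  let D := procedures P in
  [/\ no_self (main P), rtcalls_ok D (main P) &
      forall X, [/\ no_self (Body D X), no_rtcall (Body D X),
        Vars D X != [::] & {subset chor_procs D (Body D X) <= Vars D X}]].

(* Main.v *)
Require Import Defs.
From mathcomp Require Import all_boot.

(** Only the head constructor of a choreography can block it, and only when it
    is a procedure call whose list of waiting processes is empty.  Reduction
    keeps these lists nonempty: [rem] is applied only to lists of size greater
    than one, and a freshly unfolded procedure body contains no [RTCall]. *)

Lemma rem_neq_nil (T : eqType) (x : T) (s : seq T) :
  x \in s -> 1 < size s -> rem x s != [::].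
Proof. by move=> xs s_gt1; rewrite -size_eq0 size_rem // -lt0n -ltnS prednK // ltnW. Qed.

Lemma no_rtcall_rtcalls_ok (S : signature) (D : defs S) (C : chor S) :
  no_rtcall C -> rtcalls_ok D C.
Proof. by elim: C => //= p b C1 IH1 C2 IH2 /andP[/IH1 -> /IH2 ->]. Qed.

Lemma red_rtcalls_ok (S : signature) (D : defs S) (C C' : chor S)
    (s s' : state S) (r : rlabel S) :
  (forall X, no_rtcall (Body D X)) ->
  red D C s r C' s' -> rtcalls_ok D C -> rtcalls_ok D C'.
Proof.
move=> D_ok; have body_ok X := no_rtcall_rtcalls_ok _ D _ (D_ok X).
elim=> {C C' s s' r} //=.
- by move=> ? ? ? ? ? ? _ _ /andP[].
- by move=> ? ? ? ? ? ? _ _ /andP[].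
- by move=> ? ? ? ? ? ? ? ? ? _ _ IH1 _ IH2 /andP[/IH1 -> /IH2 ->].
- by move=> ? ? ? ? ? ? ? _ _ IH /and3P[-> -> /IH ->].
(* First entry into a call shared by several processes: someone is still left to wait, and the
   unfolded body satisfies the invariant because it has no [RTCall]. *)
- move=> X p _ _ _ pX X_gt1 _; rewrite rem_neq_nil //= body_ok andbT.
  by apply/allP => q /mem_rem.
- move=> X p ps C _ _ _ p_ps ps_gt1 /and3P[_ /allP sub_ps ->].
  by rewrite rem_neq_nil //= andbT; apply/allP => q /mem_rem /sub_ps.
- by move=> ? ? ? ? ? ? _ _ _ /and3P[].
Qed.

Lemma step_rtcalls_ok (S : signature) (c1 c2 : config S) (l : olabel S) :
  step c1 l c2 ->
  (forall X, no_rtcall (Body (procedures c1.1) X)) ->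
  rtcalls_ok (procedures c1.1) (main c1.1) ->
  procedures c2.1 = procedures c1.1 /\
  rtcalls_ok (procedures c2.1) (main c2.1).
Proof.
case=> D C C' s s' r red_C D_ok C_ok; split=> //.
exact: red_rtcalls_ok red_C C_ok.
Qed.

(** Constancy of the procedures is proved jointly with the invariant, so that the hypothesis on
    bodies can be transported to each intermediate configuration. *)
Lemma steps_rtcalls_ok (S : signature) (c1 c2 : config S)
    (ls : seq (olabel S)) :
  steps c1 ls c2 ->
  (forall X, no_rtcall (Body (procedures c1.1) X)) ->
  rtcalls_ok (procedures c1.1) (main c1.1) ->
  procedures c2.1 = procedures c1.1 /\
  rtcalls_ok (procedures c2.1) (main c2.1).
Proof.
elim=> [//|{}c1 c c3 l {}ls c1c _ IH] D_ok C_ok.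
have [eD c_ok] := step_rtcalls_ok _ _ _ _ c1c D_ok C_ok.
by rewrite -eD; apply: IH => //; rewrite eD.
Qed.

(** Case analysis on the head suffices, without induction: every constructor but [End] has a rule
    that executes it at once, so no delay rule is used. *)
Lemma red_progress (S : signature) (D : defs S) (C : chor S) (s : state S) :
  (forall X, Vars D X != [::]) -> rtcalls_ok D C ->
  C = End \/ exists r C' s', red D C s r C' s'.
Proof.
move=> VarsD; case: C => [[p e q x|p q l] a C|p b C1 C2|X|X ps C|] /= C_ok;
  last by left.
all: right.
- exists (RCom p (eval e (s p)) q x), C, (update s q x (eval e (s p))).
  exact: red_com.
- by exists (RSel p q l), C, s; apply: red_sel.
- case b_s: (beval b (s p)).
    by exists (RCond p), C1, s; apply: red_then.
  by exists (RCond p), C2, s; apply: red_else.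
- have: exists p, p \in Vars D X.
    by case: (Vars D X) (VarsD X) => // p ps _; exists p; rewrite mem_head.
  move=> [p pX]; exists (RCall X p); have := VarsD X.
  (* A lone process moves straight to the body, as nobody is left to wait. *)
  rewrite -size_eq0 -lt0n leq_eqVlt => /predU1P[/esym X1|X_gt1].
    by exists (Body D X), s; apply: red_call_one.
  by exists (RTCall X (rem p (Vars D X)) (Body D X)), s; apply: red_call_many.
(* Any waiting process could enter; the head of [ps] is chosen. *)
- case: ps C_ok => [//|p [|q ps]] _; exists (RCall X p).
    by exists C, s; apply: red_finish; rewrite ?mem_head.
  exists (RTCall X (rem p [:: p, q & ps]) C), s.
  by apply: red_enter; rewrite ?mem_head.
Qed.

Theorem mainTheorem4 (S : signature) (P : program S) (s : state S)
    (ls : seq (olabel S)) (P' : program S) (s' : state S) :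
  well_formed P ->
  steps (P, s) ls (P', s') ->
  main P' = End \/
  exists (l : olabel S) (c'' : config S), step (P', s') l c''.
Proof.
move=> [_ P_ok D_ok] /steps_rtcalls_ok /= H.
have {H P_ok}[|eD P'_ok] := H _ P_ok; first by move=> X; have [] := D_ok X.
have VarsD X : Vars (procedures P') X != [::].
  by rewrite eD; have [] := D_ok X.
have [->|[r [C' [s'' red_P']]]] := red_progress _ _ _ s' VarsD P'_ok; first by left.
right; exists (forget r), ((procedures P', C'), s'').
(* [step_red] speaks of an explicit pair, so [P'] is split. *)
by case: P' red_P' {eD P'_ok VarsD} => D C; apply: step_red.
Qed.
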